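(* For every nonnegative integer $n$, $$pod(n)=\sum_{j=0}^{\infty}q_{odd}(j)\,p\!\left(\frac n2-\frac j2\right),$$ where $p(x)=0$ if $x$ is not an integer.
   Context: $pod(n)$ denotes the number of partitions of $n$ in which odd parts are distinct and even parts may be repeated; $q_{odd}(n)$ denotes the number of partitions of $n$ into distinct odd parts; $p(n)$ denotes the number of (unrestricted) partitions of $n$. Each takes the value $1$ at $0$, and $p(x)=0$ if $x$ is negative. *)

(* Defs.v *)
From mathcomp Require Import all_boot all_order all_algebra.

Set Implicit Arguments.
Unset Strict Implicit.
Unset Printing Implicit Defensive.

Import Order.TTheory GRing.Theory Num.Theory.

Definition is_partition (n : nat) (s : seq nat) : bool :=
  [&& sorted geq s, all (leq 1) s & sumn s == n].

(* A partition of n has at most n parts, each at most n, so that counting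
   bounded sequences loses nothing: see is_partition_bseq. *)
Definition num_partitions (P : pred (seq nat)) (n : nat) : nat :=
  #|[set s : n.-bseq 'I_n.+1 |
      is_partition n (map val s) && P (map val s)]|.

Lemma is_partition_bseq (n : nat) (s : seq nat) :
  is_partition n s -> exists t : n.-bseq 'I_n.+1, map val t = s.
Proof.
case/and3P=> _ pos_s /eqP sum_s.
have size_s : size s <= n.
  rewrite -{}sum_s; elim: s pos_s => //= x s IHs /andP[x_gt0 /IHs].
  by rewrite -add1n; apply: leq_add.
have le_s x : x \in s -> x < n.+1.
  rewrite ltnS -{}sum_s {pos_s size_s}; elim: s => //= y s IHs.
  rewrite inE => /predU1P[->|/IHs le_xs]; first exact: leq_addr.
  exact: leq_trans le_xs (leq_addl _ _).
have map_s : map val (map (@inord n) s) = s.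
  by rewrite -map_comp map_id_in // => x /le_s /= /inordK.
have size_t : size (map (@inord n) s) <= n by rewrite size_map.
by exists (Bseq size_t).
Qed.

Definition p : nat -> nat := num_partitions predT.

Definition pod : nat -> nat :=
  num_partitions (fun s => uniq [seq x <- s | odd x]).

Definition q_odd : nat -> nat :=
  num_partitions (fun s => uniq s && all odd s).

Definition p_rat (x : rat) : nat :=
  if x \is a Num.nat then p (Num.truncn x) else 0.

(* Main.v *)
(** A partition with distinct odd parts is the same thing as a partition [a]
    into distinct odd parts (its odd parts) together with an arbitrary
    partition [b] (the halves of its even parts). If [a] is a partition of [j],
    then [b] is a partition of [(n - j) / 2], so that summing over [j] gives the
    identity; the terms with [j > n] or [n - j] odd vanish. *)
Require Import Defs.
From mathcomp Require Import all_boot all_order all_algebra.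
From mathcomp Require Import all_classical all_reals all_analysis.
From mathcomp Require Import zify ring.

Import GRing.Theory Num.Theory.

(** Listing the partitions without repetition turns a bijection into a [perm_eq] of lists and a
    count into a [size]. *)
Definition partitions (P : pred (seq nat)) (n : nat) : seq (seq nat) :=
  [seq map val (val s) | s <- enum [set s : n.-bseq 'I_n.+1 |
      is_partition n (map val s) && P (map val s)]].

Lemma size_partitions (P : pred (seq nat)) (n : nat) :
  size (partitions P n) = num_partitions P n.
Proof. by rewrite size_map -cardE. Qed.

Lemma mem_partitions (P : pred (seq nat)) (n : nat) (s : seq nat) :
  (s \in partitions P n) = is_partition n s && P s.
Proof.
apply/mapP/idP => [[t]|/andP[n_s P_s]].
  by rewrite mem_enum inE => ? ->.
have [t t_s] := @is_partition_bseq n s n_s.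
by exists t; rewrite // mem_enum inE t_s n_s.
Qed.

Lemma partitions_uniq (P : pred (seq nat)) (n : nat) : uniq (partitions P n).
Proof.
rewrite map_inj_uniq ?enum_uniq // => s t /(inj_map val_inj).
exact: val_inj.
Qed.

(** A weakly decreasing list is the canonical form of its multiset of parts, so partitions may be
    compared up to permutation. *)
Lemma geq_sorted_eq (s t : seq nat) :
  sorted geq s -> sorted geq t -> perm_eq s t -> s = t.
Proof.
apply: sorted_eq => [y x z /= yx zy|x y /andP[/= yx xy]].
  exact: leq_trans zy yx.
by apply/eqP; rewrite eqn_leq yx xy.
Qed.

Lemma geq_sorted_filter (a : pred nat) (s : seq nat) :
  sorted geq s -> sorted geq [seq x <- s | a x].
Proof. by apply: sorted_filter => y x z /= yx zy; exact: leq_trans zy yx. Qed.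

Lemma sumn_filterC (a : pred nat) (s : seq nat) :
  sumn [seq x <- s | a x] + sumn [seq x <- s | ~~ a x] = sumn s.
Proof. by rewrite -sumn_cat (perm_sumn (permEl (perm_filterC a s))). Qed.

Definition odds (s : seq nat) : seq nat := [seq x <- s | odd x].

Definition evens (s : seq nat) : seq nat := [seq x <- s | ~~ odd x].

Lemma double_half_evens (s : seq nat) :
  map double (map half (evens s)) = evens s.
Proof.
rewrite -map_comp map_id_in // => x.
by rewrite mem_filter => /andP[/even_halfK].
Qed.

Lemma sumn_map_double (s : seq nat) : sumn (map double s) = (sumn s).*2.
Proof. by elim: s => //= x s ->; rewrite doubleD. Qed.

Lemma sumn_odd_evens (s : seq nat) :
  sumn (odds s) + (sumn (map half (evens s))).*2 = sumn s.
Proof. by rewrite -sumn_map_double double_half_evens sumn_filterC. Qed.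

Definition split_parity (s : seq nat) : seq nat * seq nat :=
  (odds s, map half (evens s)).

Definition merge_parity (u : seq nat * seq nat) : seq nat :=
  sort geq (u.1 ++ map double u.2).

Lemma merge_parity_sorted (u : seq nat * seq nat) :
  sorted geq (merge_parity u).
Proof. by apply: sort_sorted => x y; exact: leq_total. Qed.

Lemma split_parityK (s : seq nat) :
  sorted geq s -> merge_parity (split_parity s) = s.
Proof.
move=> s_sorted; apply: geq_sorted_eq => //; first exact: merge_parity_sorted.
rewrite /merge_parity /= double_half_evens perm_sort.
exact: (permEl (perm_filterC odd s)).
Qed.

(** Doubled parts are even and those of [a] are odd, so parity tells the two apart after merging;
    sortedness of [a] and [b] fixes the order in which they come back. *)
Lemma merge_parityK (a b : seq nat) :
  all odd a -> sorted geq a -> sorted geq b ->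
  split_parity (merge_parity (a, b)) = (a, b).
Proof.
move=> a_odd a_sorted b_sorted.
have odd_b : odds (map double b) = [::].
  by elim: {b_sorted} b => //= x b ->; rewrite odd_double.
have even_b : evens (map double b) = map double b.
  by elim: {b_sorted odd_b} b => //= x b ->; rewrite odd_double.
have even_a : evens a = [::].
  by elim: a a_odd {a_sorted} => //= x a IHa /andP[-> /IHa ->].
(* Multisets suffice below, so the [sort] in the merge can be ignored. *)
have m_ab : perm_eq (merge_parity (a, b)) (a ++ map double b).
  by rewrite perm_sort.
have m_sorted := merge_parity_sorted (a, b).
congr (_, _).
  apply: geq_sorted_eq => //; first exact: geq_sorted_filter.
  rewrite /odds (permPl (perm_filter _ m_ab)) filter_cat.
  rewrite -/(odds a) -/(odds _) odd_b cats0.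
  by rewrite /odds (all_filterP a_odd).
have -> : evens (merge_parity (a, b)) = map double b.
  apply: geq_sorted_eq; first exact: geq_sorted_filter.
    rewrite sorted_map; apply: sub_sorted b_sorted => x y /=.
    by rewrite leq_double.
  rewrite /evens (permPl (perm_filter _ m_ab)) filter_cat.
  by rewrite -/(evens a) -/(evens _) even_a even_b.
by rewrite -map_comp (eq_map (g := id)) ?map_id // => x /=; rewrite doubleK.
Qed.

Definition odd_distinct (s : seq nat) : bool := uniq (odds s).

Definition distinct_odds (s : seq nat) : bool := uniq s && all odd s.

(** This is the bijection for a fixed sum [j] of the odd parts. Writing the total as [j + m.*2]
    avoids subtraction and halving, and makes [m] the sum of the halved even parts. *)
Lemma split_parity_partitions (m j : nat) :
  perm_eq
    [seq split_parity s | s <- partitions odd_distinct (j + m.*2)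
                        & sumn (odds s) == j]
    [seq (a, b) | a <- partitions distinct_odds j, b <- partitions predT m].
Proof.
apply: uniq_perm.
(* Splitting is injective on sorted lists because merging undoes it. *)
- rewrite map_inj_in_uniq ?filter_uniq ?partitions_uniq // => s t.
  rewrite !mem_filter !mem_partitions.
  move=> /and3P[_ /and3P[s_sorted _ _] _] /and3P[_ /and3P[t_sorted _ _] _] st.
  by rewrite -(split_parityK s) // st split_parityK.
- by apply: allpairs_uniq; rewrite ?partitions_uniq // => -[? ?] [? ?].
move=> [a b]; apply/mapP/allpairsP => /= [[s]|[[a' b'] /=]].
  rewrite mem_filter mem_partitions.
  case/and3P=> /eqP odd_j /and3P[s_sorted s_pos /eqP s_sum] s_uniq ->.
  exists (split_parity s); split => //=; rewrite mem_partitions.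
    rewrite /is_partition geq_sorted_filter // odd_j eqxx andbT.
    rewrite /distinct_odds filter_all -/(odd_distinct s) s_uniq !andbT.
    by apply/allP => x; rewrite mem_filter => /andP[_ /(allP s_pos)].
  rewrite andbT; apply/and3P; split.
  + rewrite sorted_map; apply: sub_sorted (geq_sorted_filter _ _ s_sorted).
    by move=> x y /= /half_leq.
  (* A positive even part is at least 2, so its half is still positive. *)
  + apply/allP => x /mapP[y]; rewrite mem_filter => /andP[y_even y_s ->].
    by move: (allP s_pos _ y_s) y_even => /=; lia.
  + by move: (sumn_odd_evens s); lia.
rewrite !mem_partitions andbT.
case=> /andP[/and3P[a_sorted a_pos /eqP a_sum] /andP[a_uniq a_odd]].
case/and3P=> b_sorted b_pos /eqP b_sum [-> ->].
exists (merge_parity (a', b')); last by rewrite merge_parityK.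
have odd_m : odds (merge_parity (a', b')) = a'.
  by have := congr1 fst (merge_parityK _ _ a_odd a_sorted b_sorted).
rewrite mem_filter mem_partitions odd_m a_sum eqxx /odd_distinct odd_m.
rewrite a_uniq andbT /=; apply/and3P; split; first exact: merge_parity_sorted.
  rewrite all_sort all_cat a_pos all_map /=.
  by apply: sub_all b_pos => x /=; lia.
have -> : sumn (merge_parity (a', b')) = sumn (a' ++ map double b').
  by apply: perm_sumn; rewrite perm_sort.
by rewrite sumn_cat sumn_map_double a_sum b_sum.
Qed.

Lemma size_fiber_sum (T : Type) (f : T -> nat) (n : nat) (s : seq T) :
  all (fun x => f x < n) s ->
  size s = \sum_(j < n) count (fun x => f x == j) s.
Proof.
elim: s => [_|x s IHs /= /andP[fx_lt /IHs ->]]; first by rewrite big1.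
rewrite big_split /= -[LHS]add1n; congr (_ + _).
rewrite (bigD1 (Ordinal fx_lt)) //= eqxx big1 // => j.
by rewrite -val_eqE /= eq_sym => /negbTE ->.
Qed.

Lemma pod_convolution (n : nat) :
  pod n = \sum_(j < n.+1)
    q_odd j * (if odd (n - j) then 0 else p (n - j)./2).
Proof.
rewrite /pod -size_partitions -/odd_distinct.
(* Partitions are grouped by the sum of their odd parts, which is at most [n]; hence the bound
   [n.+1]. *)
rewrite (@size_fiber_sum _ (fun s => sumn (odds s)) n.+1); last first.
  apply/allP => s; rewrite mem_partitions => /andP[/and3P[_ _ /eqP <-] _].
  by rewrite -(sumn_odd_evens s) ltnS leq_addr.
apply: eq_bigr => j _; rewrite -size_filter.
have j_le : j <= n by rewrite -ltnS.
case: ifPn => [odd_nj|even_nj].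
  (* The even parts would have the odd sum [n - j], so the fiber is empty. *)
  rewrite muln0; apply/eqP; rewrite size_filter -leqn0 leqNgt -has_count.
  apply/hasPn => s; rewrite mem_partitions => /andP[/and3P[_ _ /eqP s_sum] _].
  by apply/negP => /eqP; move: (sumn_odd_evens s); lia.
have := perm_size (split_parity_partitions (n - j)./2 j).
by rewrite size_allpairs !size_partitions size_map even_halfK // subnKC.
Qed.

(** The test [n < j] is separate because truncated subtraction would give [n - j = 0] there, hence
    [p 0 = 1] instead of 0. *)
Lemma p_rat_half_sub (n j : nat) :
  p_rat (n%:R / 2%:R - j%:R / 2%:R)%R =
  if (n < j) || odd (n - j) then 0 else p (n - j)./2.
Proof.
rewrite /p_rat; case: ifPn => [/natrP[k def_k]|not_nat].
  have def_n : n = j + k.*2.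
    apply/eqP; rewrite -(eqr_nat rat) natrD -mul2n natrM -def_k; apply/eqP.
    by field.
  rewrite def_k natrK def_n addKn odd_double doubleK.
  by rewrite ltnNge leq_addr.
case: ifPn => //; rewrite negb_or -leqNgt => /andP[j_le even_nj].
(* When [j <= n] and [n - j] is even, the argument is the natural number [(n - j)./2], a
   contradiction. *)
case/negP: not_nat; apply/natrP; exists (n - j)./2.
have def_n : n = j + (n - j)./2.*2 by rewrite even_halfK // subnKC.
by rewrite [in LHS]def_n natrD -mul2n natrM; field.
Qed.

Local Open Scope ring_scope.
Local Open Scope ereal_scope.

Theorem theorem4p2 (R : realType) (n : nat) :
  ((pod n)%:R : R)%:E =
  \sum_(0 <= j <oo)
    ((q_odd j * p_rat (n%:R / 2%:R - j%:R / 2%:R)%R)%N%:R : R)%:E.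
Proof.
(* The terms are nonnegative, so the series may be cut after [j = n]; every later term vanishes. *)
rewrite (nneseries_split 0 n.+1) => [|j _]; last by rewrite lee_fin ler0n.
rewrite add0n [X in _ + X]eseries0 => [|j j_gt _]; last first.
  by rewrite p_rat_half_sub j_gt muln0.
rewrite adde0 big_mkord sumEFin -natr_sum pod_convolution.
congr (_%:R%:E); apply: eq_bigr => j _.
by rewrite p_rat_half_sub ltnNge -ltnS ltn_ord.
Qed.
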